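(* Let $n\ge1$ and consider the linear map of $\mathbb K$-vector spaces $$\mathbb K[t]^n\to\mathcal W,\qquad(\pi_1,\dots,\pi_n)\mapsto\sum_{j=1}^n\frac{\pi_j(\tilde h_j)}{\chi_j}.$$ This map is surjective and its kernel is the vector subspace of $\mathbb K[t]^n$ spanned by the $n$-tuples $(t^j,\dots,t^j)$ for $j=0,1,\dots,n-2$. The image of the diagonal in $\mathbb K[t]^n$, formed by the $n$-tuples $(\pi,\dots,\pi)$ with $\pi\in\mathbb K[t]$, is the space $\mathcal H$.
   Context: $\mathbb K$ is a field of characteristic $0$. $U(n)=\mathbb K[\tilde h_1,\dots,\tilde h_n]$ is the commutative polynomial ring, $\tilde h_{ij}=\tilde h_i-\tilde h_j$, and $\bar U(n)$ is the localization of $U(n)$ with respect to the multiplicative set generated by all $\tilde h_{ij}+a$, $a\in\mathbb Z$, $i\ne j$. $\chi_j:=\prod_{k\ne j}\tilde h_{jk}$. $\mathcal W_j$ is the $\mathbb K$-vector space of elements $\pi(\tilde h_j)/\chi_j\in\bar U(n)$ with $\pi$ a univariate polynomial over $\mathbb K$, and $\mathcal W:=\sum_{j=1}^n\mathcal W_j$. $\mathcal H$ is the $\mathbb K$-linear span of the complete symmetric polynomials $H_L=\sum_{i_1\le\dots\le i_L}\tilde h_{i_1}\cdots\tilde h_{i_L}$, $L=0,1,2,\dots$, in $\tilde h_1,\dots,\tilde h_n$. *)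

(* Defs.v *)
From HB Require Import structures.
From mathcomp Require Import all_boot all_algebra.
From mathcomp Require Import boolp.
From mathcomp Require Import mpoly.

Set Implicit Arguments.
Unset Strict Implicit.
Unset Printing Implicit Defensive.

Import GRing.Theory.
Local Open Scope ring_scope.

Definition in_span (K : fieldType) (V : lmodType K) (I : Type) (e : I -> V)
    (v : V) : Prop :=
  exists (s : seq I) (c : I -> K), v = \sum_(i <- s) c i *: e i.

(* The multiplicative set generated by the X_i - X_j + a, i != j, a in Z;
   X_i plays the role of the variable h~_i. *)
Inductive denominator (K : fieldType) (n : nat) : {mpoly K[n]} -> Prop :=
| denominator_gen (i j : 'I_n) (a : int) :
    i != j -> denominator ('X_i - 'X_j + a%:~R)
| denominator1 : denominator 1
| denominatorM (p q : {mpoly K[n]}) :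
    denominator p -> denominator q -> denominator (p * q).

Section Localization.
Variables (K : fieldType) (n : nat).
Local Notation U := {mpoly K[n]}.
Local Notation F := {fraction U}.

(* No denominator vanishes, being a product of nonzero elements of a domain;
   the proofs below avoid this fact by using that x / 0 = 0. *)
Definition localized : {pred F} := fun x =>
  `[< exists p q : U, denominator q /\ x = tofrac p / tofrac q >].

Lemma localizedP x : x \in localized ->
  exists p q : U, [/\ denominator q, q != 0 & x = tofrac p / tofrac q].
Proof.
move=> /asboolP[p [q [Dq ->]]]; have [->|q0] := eqVneq q 0; last by exists p, q.
exists 0, 1; split; [exact: denominator1|exact: oner_neq0|].
by rewrite tofrac0 invr0 mulr0 mul0r.
Qed.

Lemma localized_subring_closed : subring_closed localized.
Proof.
have unF (q : U) : q != 0 -> tofrac q != 0 by rewrite tofrac_eq0.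
split.
- apply/asboolP; exists 1, 1; split; first exact: denominator1.
  by rewrite tofrac1 divr1.
- move=> x y /localizedP[p [q [Dq q0 ->]]] /localizedP[r [s [Ds s0 ->]]].
  apply/asboolP; exists (p * s - r * q), (q * s).
  split; first exact: denominatorM.
  rewrite tofracB !tofracM -mulNr addf_div ?unF // mulNr //.
- move=> x y /localizedP[p [q [Dq q0 ->]]] /localizedP[r [s [Ds s0 ->]]].
  apply/asboolP; exists (p * r), (q * s).
  split; first exact: denominatorM.
  by rewrite !tofracM mulf_div.
Qed.

(* The localization of K[X_1, .., X_n] at the denominators, realized inside
   the field of fractions. *)
Record Ubar : Type := MkUbar { Ubar_val :> F; _ : Ubar_val \in localized }.

HB.instance Definition _ := [isSub for Ubar_val].
HB.instance Definition _ := [Choice of Ubar by <:].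
HB.instance Definition _ :=
  GRing.SubChoice_isSubComNzRing.Build F localized Ubar
    localized_subring_closed.

Definition Ubar_unit : {pred Ubar} := fun x =>
  (val x != 0) && ((val x)^-1 \in localized).
Definition Ubar_inv (x : Ubar) : Ubar := insubd x (val x)^-1.

Lemma Ubar_mulVx : {in Ubar_unit, left_inverse 1 Ubar_inv *%R}.
Proof.
move=> x /andP[x0 xV]; apply: val_inj.
by rewrite rmorphM /= val_insubd xV mulVf.
Qed.

Lemma Ubar_unitPl (x y : Ubar) : y * x = 1 -> Ubar_unit x.
Proof.
move=> /(congr1 val); rewrite rmorphM rmorph1 => yx1.
have x0 : val x != 0.
  by apply/eqP => x0; move/esym/eqP: yx1; rewrite /= x0 mulr0 oner_eq0.
apply/andP; split=> //.
by rewrite -[_^-1]mul1r -yx1 mulfK // (valP y).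
Qed.

Lemma Ubar_inv_out : {in [predC Ubar_unit], Ubar_inv =1 id}.
Proof.
move=> x; rewrite inE /= negb_and negbK => xNu; apply: val_inj.
rewrite val_insubd; case: ifP => // xV; move: xNu.
by rewrite xV orbF => /eqP ->; rewrite invr0.
Qed.

HB.instance Definition _ := GRing.ComNzRing_hasMulInverse.Build Ubar
  Ubar_mulVx Ubar_unitPl Ubar_inv_out.

Lemma localized_tofrac (p : U) : tofrac p \in localized.
Proof.
apply/asboolP; exists p, 1; split; first exact: denominator1.
by rewrite tofrac1 divr1.
Qed.

Definition toUbar (p : U) : Ubar := MkUbar (localized_tofrac p).

Lemma toUbar_zmod : zmod_morphism toUbar.
Proof. by move=> p q; apply: val_inj; rewrite rmorphB /= tofracB. Qed.
Lemma toUbar_monoid : monoid_morphism toUbar.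
Proof.
split=> [|p q]; apply: val_inj; first by rewrite rmorph1 /= tofrac1.
by rewrite rmorphM /= tofracM.
Qed.
HB.instance Definition _ := GRing.isZmodMorphism.Build U Ubar toUbar toUbar_zmod.
HB.instance Definition _ :=
  GRing.isMonoidMorphism.Build U Ubar toUbar toUbar_monoid.

Definition Ubar_scale (c : K) (x : Ubar) : Ubar := toUbar c%:MP * x.

Lemma Ubar_scaleA a b v : Ubar_scale a (Ubar_scale b v) = Ubar_scale (a * b) v.
Proof. by rewrite /Ubar_scale mulrA -rmorphM -mpolyCM. Qed.
Lemma Ubar_scale1 : left_id 1 Ubar_scale.
Proof. by move=> v; rewrite /Ubar_scale mpolyC1 rmorph1 mul1r. Qed.
Lemma Ubar_scaleDr : right_distributive Ubar_scale +%R.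
Proof. by move=> a u v; rewrite /Ubar_scale mulrDr. Qed.
Lemma Ubar_scaleDl v : {morph Ubar_scale^~ v : a b / a + b}.
Proof. by move=> a b; rewrite /Ubar_scale mpolyCD rmorphD mulrDl. Qed.
HB.instance Definition _ := GRing.Zmodule_isLmodule.Build K Ubar
  Ubar_scaleA Ubar_scale1 Ubar_scaleDr Ubar_scaleDl.
Lemma Ubar_scaleAl (a : K) (u v : Ubar) : a *: (u * v) = (a *: u) * v.
Proof. exact: mulrA. Qed.
HB.instance Definition _ := GRing.Lmodule_isLalgebra.Build K Ubar Ubar_scaleAl.
HB.instance Definition _ := GRing.Lalgebra_isComAlgebra.Build K Ubar.

Definition h (j : 'I_n) : Ubar := toUbar 'X_j.

Definition chi (j : 'I_n) : Ubar := \prod_(k < n | k != j) (h j - h k).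

Lemma chi_unit (j : 'I_n) : chi j \is a GRing.unit.
Proof.
apply: rpred_prod => k kj; rewrite /h -rmorphB.
have jkD : denominator ('X_j - 'X_k : U).
  by rewrite -[X in denominator X]addr0 -(mulr0z 1); apply: denominator_gen;
    rewrite eq_sym.
have jk0 : 'X_j - 'X_k != 0 :> U.
  rewrite subr_eq0; apply/eqP => /(congr1 (mcoeff U_(j))).
  by rewrite !mcoeffX eqxx eq_mnm1 (negPf kj) => /eqP; rewrite oner_eq0.
apply/andP; split; first by rewrite /= tofrac_eq0.
apply/asboolP; exists 1, ('X_j - 'X_k); split=> //.
by rewrite tofrac1 div1r.
Qed.

(* [horner_alg (h j) pi] is the value pi(h~_j). *)
Definition W_ (j : 'I_n) (x : Ubar) : Prop :=
  exists pi : {poly K}, x = horner_alg (h j) pi / chi j.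

Definition inW : {pred Ubar} := fun x =>
  `[< exists2 w : 'I_n -> Ubar, forall j, W_ j (w j) & x = \sum_(j < n) w j >].

Lemma inW_submod_closed : submod_closed inW.
Proof.
split.
  apply/asboolP; exists (fun=> 0); last by rewrite big1.
  by move=> j; exists 0; rewrite rmorph0 mul0r.
move=> a x y /asboolP[u Wu ->] /asboolP[v Wv ->].
apply/asboolP; exists (fun j => a *: u j + v j).
  move=> j; have [p ->] := Wu j; have [q ->] := Wv j.
  by exists (a *: p + q); rewrite linearP /= mulr_algl mulrDl -scalerAl.
by rewrite big_split -scaler_sumr.
Qed.

Record W : Type := MkW { W_val :> Ubar; _ : W_val \in inW }.

HB.instance Definition _ := [isSub for W_val].
HB.instance Definition _ := [Choice of W by <:].
HB.instance Definition _ :=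
  GRing.SubChoice_isSubLmodule.Build K Ubar inW W inW_submod_closed.

Lemma fraction_sum_inW (p : {ffun 'I_n -> {poly K}}) :
  \sum_(j < n) horner_alg (h j) (p j) / chi j \in inW.
Proof.
apply/asboolP; exists (fun j => horner_alg (h j) (p j) / chi j) => // j.
by exists (p j).
Qed.

Definition fraction_sum (p : {ffun 'I_n -> {poly K}}) : W :=
  MkW (fraction_sum_inW p).

Lemma fraction_sum_linear : linear fraction_sum.
Proof.
move=> a p q; apply: val_inj; rewrite linearP /= scaler_sumr -big_split /=.
by apply: eq_bigr => j _; rewrite !ffunE linearP /= mulr_algl mulrDl -scalerAl.
Qed.
HB.instance Definition _ :=
  GRing.isLinear.Build K {ffun 'I_n -> {poly K}} W _ fraction_sum
    fraction_sum_linear.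

Definition complete_sym (L : nat) : U :=
  \sum_(t : L.-tuple 'I_n | sorted leq (map val t)) \prod_(i <- t) 'X_i.

Definition Hspace (x : Ubar) : Prop :=
  in_span (fun L : nat => toUbar (complete_sym L)) x.

End Localization.

Definition diag (K : fieldType) (n : nat) (p : {poly K}) :
  {ffun 'I_n -> {poly K}} := [ffun=> p].
Arguments fraction_sum {K n} p.
Arguments Hspace {K n} x.

(* Main.v *)
(** Evaluated at [h_i], the relation [\sum_j p_j(h_j) / chi_j = 0] says that
    [p_i(h_i)] is the value at [h_i] of the Lagrange interpolation polynomial, of
    degree at most [n - 2], with values [p_j(h_j)] at the nodes [h_j], [j != i].
    Hence [p_i] has degree at most [n - 2] and takes the value [p_j(h_j)] at
    [h_j], so all the [p_j] are equal.  On the diagonal, the sums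
    [\sum_j h_j^m / chi_j] are divided differences of [t^m]; removing one variable
    [h_a] gives [S_(m+1) = h_a S_m + S'_m], which is also the recurrence of the
    complete symmetric polynomials, so that [S_m = H_(m - n + 1)], read as [0]
    for [m < n - 1]. *)
From HB Require Import structures.
Require Import Defs.
From mathcomp Require Import all_boot all_algebra boolp mpoly ring.
Set Implicit Arguments.
Unset Strict Implicit.
Unset Printing Implicit Defensive.
Import GRing.Theory.
Local Open Scope ring_scope.

(** * Divided differences of powers *)

Section PowerSums.
Variables (F : fieldType) (I : eqType) (x : I -> F).
Hypothesis x_inj : injective x.

Definition divdiff (m : nat) (s : seq I) : F :=
  \sum_(i <- s) x i ^+ m / \prod_(k <- s | k != i) (x i - x k).

Lemma divdiff1 m a : divdiff m [:: a] = x a ^+ m.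
Proof. by rewrite /divdiff big_seq1 big_cons eqxx big_nil divr1. Qed.

(** Writing [x i ^+ m.+1] as [x a * x i ^+ m + (x i - x a) * x i ^+ m], the second part cancels the
    factor that the node [a] contributes to the denominator. *)
Lemma divdiff_cons m a s : uniq (a :: s) ->
  divdiff m.+1 (a :: s) = x a * divdiff m (a :: s) + divdiff m s.
Proof.
move=> /= /andP[as_ us].
rewrite /divdiff !big_cons mulrDr exprS -mulrA -addrA; congr (_ + _).
rewrite mulr_sumr -big_split /= !big_seq; apply: eq_bigr => i si.
rewrite big_cons; have ai : a != i by apply: contraNneq as_ => ->.
have xai : x i - x a != 0 by rewrite subr_eq0 inj_eq // eq_sym.
have P0 : \prod_(k <- s | k != i) (x i - x k) != 0.
  rewrite prodf_seq_neq0; apply/allP => k _; apply/implyP => ki.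
  by rewrite subr_eq0 inj_eq // eq_sym.
by rewrite ai exprS; field; rewrite P0.
Qed.

Lemma perm_divdiff m s t : perm_eq s t -> divdiff m s = divdiff m t.
Proof.
move=> st; rewrite /divdiff (perm_big _ st); apply: eq_bigr => i _.
by rewrite (perm_big _ st).
Qed.

(** Removing either of two nodes [a], [b] from the first-power sum gives two recurrences. By
    induction their remainders agree, so the difference reads [(x a - x b) * divdiff 0 s = 0]. *)
Lemma divdiff0 s : uniq s -> (1 < size s)%N -> divdiff 0 s = 0.
Proof.
elim: {s}(size s) {-2}s (erefl (size s)) => [s' -> //|d IH [|a [|b s]] //= [ds] us _].
have {}IH c : uniq (c :: s) -> divdiff 0 (c :: s) = (s == [::])%:R.
  case: s ds {us} => [|e s] ds us; first by rewrite divdiff1.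
  by rewrite IH.
have Ea := divdiff_cons 0 us.
have ba : perm_eq (a :: b :: s) (b :: a :: s).
  by rewrite -[a :: b :: s]/([:: a] ++ [:: b] ++ s) perm_catCA.
have us' : uniq (b :: a :: s) by rewrite -(perm_uniq ba).
have := divdiff_cons 0 us'; rewrite -!(perm_divdiff _ ba) Ea.
rewrite !IH; last 2 first.
- by case/andP: us'.
- by case/andP: us.
move/addIr/eqP; rewrite -subr_eq0 -mulrBl mulf_eq0 => /orP[|/eqP//].
rewrite subr_eq0 inj_eq // => /eqP ab.
by move: us; rewrite ab /= inE eqxx.
Qed.

Lemma divdiff_small m s : uniq s -> (m.+1 < size s)%N -> divdiff m s = 0.
Proof.
elim: m s => [|m IH] [|a s] // us ms; first exact: divdiff0.
rewrite divdiff_cons // !IH ?mulr0 ?addr0 //; last exact: ltnW.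
by case/andP: us.
Qed.

End PowerSums.

(** * Lagrange interpolation without denominators *)

Section Interpolation.
Variables (F : fieldType) (I : finType) (x : I -> F).
Hypothesis x_inj : injective x.

(** This is Lagrange's formula at [x i] with nodes [x j], [j != i], multiplied by all its
    denominators [c l]. Being free of division, it survives substitutions that make nodes
    coincide. *)
Lemma interpolation_cleared (f : I -> F) (i : I) :
  let c l := \prod_(k | (k != l) && (k != i)) (x l - x k) in
  \sum_j f j / \prod_(k | k != j) (x j - x k) = 0 ->
  f i * \prod_(l | l != i) c l =
  \sum_(j | j != i) f j * \prod_(k | (k != i) && (k != j)) (x i - x k)
                        * \prod_(l | (l != i) && (l != j)) c l.
Proof.
move=> c; rewrite (bigD1 i) //= => /eqP; rewrite addr_eq0 => /eqP fi.
have nz j (P : pred I) : ~~ P j -> \prod_(k | P k) (x j - x k) != 0.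
  move=> Pj; apply/prodf_neq0 => k Pk; rewrite subr_eq0 inj_eq //.
  by apply: contraNneq Pj => ->.
have chi_i0 : \prod_(k | k != i) (x i - x k) != 0 by apply: nz; rewrite eqxx.
rewrite -[f i](divfK chi_i0) fi !mulNr !mulr_suml -sumrN.
apply: eq_bigr => j ji.
have c0 : c j != 0 by apply: nz; rewrite eqxx.
have xij : x j - x i != 0 by rewrite subr_eq0 inj_eq.
have -> : \prod_(k | k != j) (x j - x k) = (x j - x i) * c j.
  by rewrite (bigD1 i) 1?eq_sym.
rewrite (bigD1 j ji) /= [\prod_(l | l != i) c l](bigD1 j ji) /=.
by field; rewrite c0.
Qed.

End Interpolation.

(** * Complete symmetric polynomials as divided differences *)

Section CompleteSymmetric.
Variables (K : fieldType) (n : nat).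

(* [path leq k] says sorted with all entries at least [k]: these are the
   complete symmetric polynomials in [X_k, .., X_(n-1)]. *)
Definition complete_sym_from (k L : nat) : {mpoly K[n]} :=
  \sum_(t : L.-tuple 'I_n | path leq k (map val t)) \prod_(i <- t) 'X_i.

Lemma complete_sym_from0 L : complete_sym_from 0 L = complete_sym K n L.
Proof.
by apply: eq_bigl => t; rewrite path_sortedE ?all_predT //; apply: leq_trans.
Qed.

Lemma complete_sym_fromS k L :
  complete_sym_from k L.+1 =
  \sum_(i < n | (k <= i)%N) 'X_i * complete_sym_from i L.
Proof.
rewrite /complete_sym_from.
under [RHS]eq_bigr do rewrite mulr_sumr.
rewrite pair_big_dep /=.
rewrite (reindex (fun p : 'I_n * L.-tuple 'I_n => [tuple of p.1 :: p.2])) /=.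
  by apply: eq_bigr => p _; rewrite big_cons.
exists (fun t : L.+1.-tuple 'I_n => (thead t, [tuple of behead t])).
  by move=> [i t] _; congr (_, _); apply: val_inj.
by move=> t _; rewrite /= -tuple_eta.
Qed.

Lemma complete_sym_from_nil k : complete_sym_from k 0 = 1.
Proof.
rewrite /complete_sym_from (big_pred1 [tuple]) ?big_nil //.
by move=> t; rewrite tuple0 /=.
Qed.

(** A monomial in [X_k, .., X_(n-1)] either contains [X_k] or involves only later variables. *)
Lemma complete_sym_from_rec (k : 'I_n) L :
  complete_sym_from k L.+1 =
  'X_k * complete_sym_from k L + complete_sym_from k.+1 L.+1.
Proof.
rewrite !complete_sym_fromS (bigD1 k) //=; congr (_ + _).
by apply: eq_bigl => i; rewrite ltn_neqAle andbC eq_sym.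
Qed.

Lemma complete_sym_from_over L : complete_sym_from n L.+1 = 0.
Proof. by rewrite complete_sym_fromS big1 // => i; rewrite leqNgt ltn_ord. Qed.

Definition Xfrac (i : 'I_n) : {fraction {mpoly K[n]}} := tofrac 'X_i.

Lemma mpolyX_inj : injective (fun i : 'I_n => 'X_i : {mpoly K[n]}).
Proof.
move=> i j /= /(congr1 (mcoeff U_(j))); rewrite !mcoeffX eqxx eq_mnm1.
by case: eqP => // _ /esym/eqP; rewrite oner_eq0.
Qed.

Lemma Xfrac_inj : injective Xfrac.
Proof. by move=> i j /eqP; rewrite tofrac_eq => /eqP/mpolyX_inj. Qed.

(** Double induction, on the number [d.+1] of nodes and then on [L]: both sides obey the same
    recurrence, and a single node gives a pure power. *)
Lemma divdiff_complete_sym_from d k L : (k + d.+1)%N = n ->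
  divdiff Xfrac (L + d) (drop k (enum 'I_n)) = tofrac (complete_sym_from k L).
Proof.
elim: d k L => [|d IH] k L kd.
  have kn : (k < n)%N by rewrite -kd addn1.
  rewrite (drop_nth (Ordinal kn)) ?size_enum_ord // drop_oversize; last first.
    by rewrite size_enum_ord -kd addn1.
  have -> : nth (Ordinal kn) (enum 'I_n) k = Ordinal kn.
    by apply: val_inj; rewrite /= nth_enum_ord.
  rewrite addn0 divdiff1; elim: L => [|L IH].
    by rewrite complete_sym_from_nil tofrac1.
  rewrite exprS IH -[k in RHS]/(val (Ordinal kn)) complete_sym_from_rec /=.
  have -> : k.+1 = n by rewrite -kd addn1.
  by rewrite complete_sym_from_over addr0 tofracM.
have kn : (k < n)%N by rewrite -kd -addSnnS leq_addr.
have kd' : (k.+1 + d.+1)%N = n by rewrite addSnnS.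
have ud j : uniq (drop j (enum 'I_n)) by rewrite drop_uniq // enum_uniq.
have sd j : size (drop j (enum 'I_n)) = (n - j)%N by rewrite size_drop size_enum_ord.
have := drop_nth (Ordinal kn) (s := enum 'I_n) (n := k); rewrite size_enum_ord.
move=> /(_ kn); have -> : nth (Ordinal kn) (enum 'I_n) k = Ordinal kn.
  by apply: val_inj; rewrite /= nth_enum_ord.
move=> dk; have rec m := divdiff_cons Xfrac_inj m (a := Ordinal kn).
move: (rec ^~ (drop k.+1 (enum 'I_n))); rewrite -dk => {}rec.
rewrite addnS rec //; elim: L => [|L IHL].
  (* Here the exponent is [d] for [d.+2] nodes, so the first term of the recurrence vanishes. *)
  rewrite divdiff_small //; last 2 first.
  - exact: Xfrac_inj.
  - by rewrite sd -kd addKn add0n.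
  by rewrite mulr0 add0r IH // !complete_sym_from_nil.
rewrite (IH k.+1) // addSn rec // IHL -[k in RHS]/(val (Ordinal kn)).
by rewrite complete_sym_from_rec tofracD tofracM.
Qed.

End CompleteSymmetric.

Lemma polyE_monomials (R : nzRingType) (p : {poly R}) m : (size p <= m)%N ->
  p = \sum_(i < m) p`_i *: 'X^i.
Proof.
move=> pm; rewrite -poly_def; apply/polyP => i; rewrite coef_poly.
by case: ltnP => // mi; rewrite nth_default // (leq_trans pm).
Qed.

(** * Specializing the kernel relation, and the values on diagonal monomials *)

Section FractionSum.
Variables (K : fieldType) (n : nat).
Local Notation U := {mpoly K[n]}.

Lemma horner_alg_h j (p : {poly K}) :
  horner_alg (h K j) p = toUbar (horner_alg ('X_j : U) p).
Proof.
elim/poly_ind: p => [|p c IH]; first by rewrite !rmorph0.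
rewrite !(rmorphD, rmorphM) /= IH !horner_algX !horner_algC alg_mpolyC.
by congr (_ + _); apply: mulr1.
Qed.

Lemma mmap_horner_alg (v : 'I_n -> {poly K}) j (p : {poly K}) :
  mmap polyC v (horner_alg ('X_j : U) p) = p \Po v j.
Proof.
elim/poly_ind: p => [|p c IH]; first by rewrite !(rmorph0, comp_poly0).
rewrite !(rmorphD, rmorphM) /= IH !horner_algX !horner_algC.
by rewrite alg_mpolyC mmapX mmapC mmap1U comp_polyX comp_polyC.
Qed.

Lemma val_fraction_sum (p : {ffun 'I_n -> {poly K}}) :
  val (val (fraction_sum p)) =
  \sum_j tofrac (horner_alg ('X_j : U) (p j)) /
         \prod_(k | k != j) (Xfrac K j - Xfrac K k).
Proof.
rewrite [val (fraction_sum p)]/= rmorph_sum; apply: eq_bigr => j _.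
rewrite rmorphM rmorphV ?chi_unit // horner_alg_h; congr (_ / _).
by rewrite rmorph_prod; apply: eq_bigr => k _; rewrite rmorphB.
Qed.

(** The cleared relation descends from the fraction field to the polynomial ring, where the
    substitution of any [v k] for [X_k] is a ring morphism. The [v k] may coincide. *)
Lemma fraction_sum_kernel_comp (p : {ffun 'I_n -> {poly K}})
    (v : 'I_n -> {poly K}) (i : 'I_n) :
  let c l := \prod_(k | (k != l) && (k != i)) (v l - v k) in
  fraction_sum p = 0 ->
  (p i \Po v i) * \prod_(l | l != i) c l =
  \sum_(j | j != i)
     (p j \Po v j) * \prod_(k | (k != i) && (k != j)) (v i - v k)
                   * \prod_(l | (l != i) && (l != j)) c l.
Proof.
move=> c /(congr1 (fun w => val (val w))); rewrite val_fraction_sum.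
move=> /(interpolation_cleared (@Xfrac_inj K n) i) E.
pose cU l : U := \prod_(k | (k != l) && (k != i)) ('X_l - 'X_k).
have {}E : horner_alg 'X_i (p i) * \prod_(l | l != i) cU l =
  \sum_(j | j != i)
     horner_alg 'X_j (p j) * \prod_(k | (k != i) && (k != j)) ('X_i - 'X_k)
                   * \prod_(l | (l != i) && (l != j)) cU l.
  apply/eqP; rewrite -tofrac_eq tofracM rmorph_sum; apply/eqP.
  have Ec l : tofrac (cU l) =
      \prod_(k | (k != l) && (k != i)) (Xfrac K l - Xfrac K k).
    by rewrite rmorph_prod; apply: eq_bigr => k _; rewrite rmorphB.
  rewrite !rmorph_prod /=; under eq_bigr do rewrite Ec.
  rewrite E; apply: eq_bigr => j _.
  rewrite !tofracM !rmorph_prod; congr (_ * _ * _).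
    by apply: eq_bigr => k _; rewrite rmorphB.
  by apply: eq_bigr => k _; rewrite /= Ec.
have vX k : mmap polyC v ('X_k : U) = v k by rewrite mmapX mmap1U.
have vc l : mmap polyC v (cU l) = c l.
  by rewrite rmorph_prod; apply: eq_bigr => k _; rewrite rmorphB /= !vX.
move/(congr1 (mmap polyC v)): E.
rewrite rmorphM rmorph_sum rmorph_prod /= mmap_horner_alg.
under eq_bigr do rewrite vc.
move=> ->; apply: eq_bigr => j _.
rewrite !rmorphM !rmorph_prod /= mmap_horner_alg; congr (_ * _ * _).
  by apply: eq_bigr => k _; rewrite rmorphB /= !vX.
by apply: eq_bigr => l _; rewrite vc.
Qed.

Lemma fraction_sum_diagXn m : (0 < n)%N ->
  val (fraction_sum (diag n ('X^m : {poly K}))) =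
  if (m < n.-1)%N then 0 else toUbar (complete_sym K n (m - n.-1)).
Proof.
move=> n0; apply: val_inj; rewrite val_fraction_sum.
transitivity (divdiff (@Xfrac K n) m (enum 'I_n)).
  rewrite /divdiff big_enum /=; apply: eq_bigr => j _.
  by rewrite ffunE rmorphXn /= horner_algX tofracXn big_enum_cond.
case: ltnP => mn.
  rewrite divdiff_small ?enum_uniq ?rmorph0 //; first exact: Xfrac_inj.
  by rewrite size_enum_ord -ltn_predRL.
have := @divdiff_complete_sym_from K n n.-1 0 (m - n.-1).
by rewrite add0n prednK // subnK // drop0 complete_sym_from0 => ->.
Qed.

(** * The kernel in characteristic 0 *)

Hypothesis K0 : [pchar K] =i pred0.

(** Characteristic 0 supplies the distinct constants that serve as nodes in the specializations
    below. *)
Lemma natr_inj : injective (fun i : 'I_n => i%:R : K).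
Proof.
move=> i j /= ij; apply: val_inj => /=.
wlog le_ij : i j ij / (i <= j)%N.
  by move=> W; case: (leqP i j) => [/W->|/ltnW/W->].
apply/eqP; rewrite eqn_leq le_ij /= -subn_eq0.
by rewrite -((pcharf0P K).1 K0) natrB // ij subrr.
Qed.

Lemma fraction_sum_kernel_diag (p : {ffun 'I_n -> {poly K}}) (i j : 'I_n) :
  fraction_sum p = 0 -> p i = p j.
Proof.
have [-> //|ij] := eqVneq i j; move=> p0.
(* Setting [X_i = X_j = 'X] kills every term of the sum but the [j]-th; the
   shifts keep the other nodes distinct, so that the cofactor is nonzero. *)
pose v k : {poly K} := 'X + (if k == i then 0 else k%:R - j%:R)%:P.
have vi : v i = 'X by rewrite /v eqxx addr0.
have vj : v j = 'X by rewrite /v eq_sym (negPf ij) subrr addr0.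
have c0 l (P : pred 'I_n) : l != i -> ~~ P l ->
    \prod_(k | P k && (k != i)) (v l - v k) != 0.
  move=> li Pl; apply/prodf_neq0 => k /andP[Pk ki].
  rewrite /v (negPf li) (negPf ki) opprD addrACA subrr add0r -polyCB polyC_eq0.
  rewrite opprB addrA subrK subr_eq0; apply: contraNneq Pl.
  by move=> /natr_inj ->.
have := fraction_sum_kernel_comp v i p0.
rewrite /= [X in _ = X](bigD1 j) 1?eq_sym //=.
rewrite [X in _ = _ + X]big1 ?addr0; last first.
  move=> k /andP[ki kj]; rewrite (bigD1 j) /=; last first.
    by rewrite eq_sym ij eq_sym.
  by rewrite vi vj subrr mul0r mulr0 mul0r.
(* As [v i = v j], the product over [k] on the right equals the factor of index [j] on the left, so
   both sides have the same cofactor. *)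
rewrite vi vj !comp_polyXr [X in _ * X = _](bigD1 j) 1?eq_sym //=.
rewrite -mulrA vj.
under [X in _ = _ * (X * _)]eq_bigl do rewrite andbC.
apply: mulIf; rewrite mulf_neq0 //.
  by rewrite -vj; apply: c0; rewrite 1?eq_sym ?eqxx.
by apply/prodf_neq0 => l /andP[li lj]; apply: c0; rewrite ?eqxx.
Qed.

(** With [X_i] sent to the indeterminate and the other variables to distinct constants, a nonzero
    multiple of [p i] becomes a combination of Lagrange products, each with [n - 2] linear
    factors. *)
Lemma fraction_sum_kernel_size (p : {ffun 'I_n -> {poly K}}) (i : 'I_n) :
  fraction_sum p = 0 -> (size (p i) <= n.-1)%N.
Proof.
move=> p0.
pose v k : {poly K} := if k == i then 'X else (k%:R)%:P.
have vi : v i = 'X by rewrite /v eqxx.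
have vk k : k != i -> v k = (k%:R)%:P by rewrite /v => /negPf ->.
pose c l : K := \prod_(k < n | (k != l) && (k != i)) (l%:R - k%:R).
have Ec l : l != i -> \prod_(k | (k != l) && (k != i)) (v l - v k) = (c l)%:P.
  move=> li; rewrite rmorph_prod; apply: eq_bigr => k /andP[_ ki].
  by rewrite !vk // rmorphB.
have C0 : \prod_(l < n | l != i) c l != 0.
  apply/prodf_neq0 => l li; apply/prodf_neq0 => k /andP[kl _].
  by rewrite subr_eq0 eq_sym; apply: contra_neq kl => /natr_inj.
have := fraction_sum_kernel_comp v i p0; rewrite /= vi comp_polyXr.
under eq_bigr => l li do rewrite Ec //.
rewrite -rmorph_prod mulrC mul_polyC => /(congr1 (size \o polyseq)) /=.
rewrite size_scale // => ->.
apply: leq_trans (size_sum _ _ _) _; apply/bigmax_leqP => j ji.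
rewrite vk // comp_polyCr.
under [X in _ * X]eq_bigr => l /andP[li _] do rewrite Ec //.
rewrite -rmorph_prod mulrAC -polyCM mul_polyC.
apply: leq_trans (size_scale_leq _ _) _.
under eq_bigr => k /andP[ki _] do rewrite vk //.
rewrite -big_filter size_prod_XsubC.
have -> : [seq k <- index_enum 'I_n | (k != i) && (k != j)] =
          enum (~: [set i; j]).
  by apply: eq_filter => k; rewrite !inE negb_or.
rewrite -cardE cardsCs setCK card_ord.
(* The two distinct indices force [2 <= n], so the truncated [n - 2] is exact. *)
have := max_card (mem [set i; j]); rewrite card_ord cards2 eq_sym ji => n2.
by rewrite -subn1 ltn_sub2l.
Qed.

Lemma diag_linear : linear (@diag K n).
Proof. by move=> a p q; apply/ffunP => j; rewrite !ffunE. Qed.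

HB.instance Definition _ :=
  GRing.isLinear.Build K {poly K} {ffun 'I_n -> {poly K}} _ (@diag K n)
    diag_linear.

End FractionSum.

(** * Surjectivity, kernel, and image of the diagonal *)

Theorem mainTheorem4 (K : fieldType) (hK : [pchar K] =i pred0)
    (n : nat) (hn : (1 <= n)%N) :
  let Phi : {linear {ffun 'I_n -> {poly K}} -> W K n} := fraction_sum in
  [/\ (forall w : W K n, exists p : {ffun 'I_n -> {poly K}}, Phi p = w),
      (forall p : {ffun 'I_n -> {poly K}},
         Phi p = 0 <-> in_span (fun j : 'I_n.-1 => diag n ('X^j : {poly K})) p)
    & (forall x : Ubar K n,
         (exists pi : {poly K}, x = Phi (diag n pi)) <-> Hspace x)].
Proof.
move=> Phi.
have PhiXn m : val (Phi (diag n 'X^m)) =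
    if (m < n.-1)%N then 0 else toUbar (complete_sym K n (m - n.-1)).
  exact: fraction_sum_diagXn.
have PhiS (I : Type) (s : seq I) (c : I -> K) (m : I -> nat) :
    val (Phi (diag n (\sum_(i <- s) c i *: 'X^(m i)))) =
    \sum_(i <- s) c i *: val (Phi (diag n 'X^(m i))).
  by rewrite !linear_sum; apply: eq_bigr => i _; rewrite !linearZ.
split=> [w | p | x].
- case: w => x xW; have /asboolP[u Wu xu] := xW.
  have [p Ep] := fin_all_exists Wu.
  exists [ffun j => p j]; apply: val_inj => /=.
  by rewrite xu; apply: eq_bigr => j _; rewrite ffunE -Ep.
- split=> [p0 | [s [c ->]]].
    pose i0 := Ordinal hn.
    have -> : p = diag n (p i0).
      by apply/ffunP => j; rewrite ffunE; apply: fraction_sum_kernel_diag.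
    exists (index_enum 'I_n.-1), (fun j => (p i0)`_j).
    rewrite {1}(polyE_monomials (fraction_sum_kernel_size hK i0 p0)).
    by rewrite linear_sum; apply: eq_bigr => j _; rewrite linearZ.
  rewrite linear_sum big1 // => j _; rewrite linearZ /=.
  rewrite [X in _ *: X](_ : _ = 0) ?scaler0 //; apply: val_inj.
  by rewrite PhiXn ltn_ord raddf0.
- split=> [[p ->] | [s [c ->]]].
    (* The monomials below degree [n - 1] are killed, and the one of degree [n - 1 + L] is sent to
       [H_L]. The sum runs up to [n.-1 + size p], past the degree of [p], so that it splits at
       [n.-1] for every [p]. *)
    exists (index_iota 0 (size p)), (fun L => p`_(n.-1 + L)).
    transitivity (val (Phi (diag n (\sum_(i < n.-1 + size p) p`_i *: 'X^i)))).
      by rewrite -polyE_monomials ?leq_addl.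
    rewrite PhiS big_split_ord big1 => [|j _]; last first.
      by rewrite PhiXn /= ltn_ord scaler0.
    rewrite [LHS]add0r big_mkord; apply: eq_bigr => j _.
    by rewrite PhiXn /= ltnNge leq_addr addKn.
  exists (\sum_(L <- s) c L *: 'X^(n.-1 + L)).
  rewrite [RHS]PhiS; apply: eq_bigr => L _.
  by rewrite PhiXn ltnNge leq_addr addKn.
Qed.
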